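(* Let $r\ne0$ be a number, let $p(x),q(x),v(x)$ be non-zero polynomials, let $w(x)$ be a polynomial, and let $g(x)=\sum_{n\ge0}g_nx^n$ be a power series which is the expansion of $$g(x)=\frac{w(x)+v(x)\sqrt[r]{p(x)}}{q(x)}.$$ Define the polynomials $$R=rpqv=\sum_{n=0}^{\deg R}R_nx^n,\qquad Q=rp(q'v-qv')-vp'q=\sum_{n=0}^{\deg Q}Q_nx^n,$$ $$H=rp(w'v-wv')-vp'w,$$ and set $R_n=0$ and $Q_n=0$ whenever $n<0$ or $n$ exceeds the respective degree. Then the coefficients $g_n$ satisfy the P-finite recurrence $$\sum_{j=0}^{\deg R}\bigl[(n-j)R_j+Q_{j-1}\bigr]g_{n-j}=0\qquad\text{for all integers } n \text{ with } n-\deg R>\deg H .$$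
   Context: Polynomials have complex coefficients and $r$ is a non-zero complex number (not required to be an integer or positive). Primes denote $d/dx$. The degree of the zero polynomial is taken to be $0$. $\sqrt[r]{p(x)}=p(x)^{1/r}$ denotes an analytic branch, i.e. $\exp(\frac1r L(x))$ where $L$ is analytic with $\exp(L(x))=p(x)$. The statement that the power series $g(x)=\sum_{n\ge0}g_nx^n$ is the expansion of the given expression means: $g$ has a positive radius of convergence, and on some non-empty open connected subset of its disc of convergence $g$ equals the given expression for some choice of analytic branch of the root (the expression being well defined there). A P-finite recurrence is a linear recurrence whose coefficients are polynomials in $n$.
   Formalization: When p, q, v are all constant (deg R = 0), the single value n = deg w is excluded; there, for non-constant w, the recurrence as printed fails (e.g. r = p = q = v = 1, w = x, g = 1 + x, n = 1). *)

(* Defs.v *)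
From HB Require Import structures.
From mathcomp Require Import all_boot all_order all_algebra.
From mathcomp Require Import complex.
From mathcomp Require Import all_classical all_reals all_analysis.

Set Implicit Arguments.
Unset Strict Implicit.
Unset Printing Implicit Defensive.

Import Order.TTheory GRing.Theory Num.Theory.
Import numFieldNormedType.Exports.

Local Open Scope classical_set_scope.
Local Open Scope ring_scope.

(* The complex numbers over a model R of the reals are R[i]; they carry the
   topology of their modulus, inherited from the regular module R[i]^o. *)
#[export, non_forgetful_inheritance]
HB.instance Definition _ (R : realType) := NormedModule.copy R[i] (R[i])^o.

Section PowerSeries.
Variable R : realType.
Implicit Types (a g : nat -> R[i]) (U : set R[i]) (z : R[i]).

(* The norm `|z| of R[i] takes its values in R[i] (with zero imaginary part). *)
Definition modulus z : R := complex.Re `|z|.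

(* The sequence of partial sums of \sum_n a_n z^n; exp.v's pseries is restricted
   to a real variable. *)
Definition cpseries a z : nat -> R[i] := series (fun n => a n * z ^+ n).

Definition convergence_radius a : \bar R :=
  ereal_sup [set (modulus z)%:E | z in [set z | cvgn (cpseries a z)]].

Definition convergence_disc a : set R[i] :=
  [set z | ((modulus z)%:E < convergence_radius a)%E].

Definition cexp z : R[i] := limn (cpseries (fun n => n`!%:R^-1) z).

Definition analytic_on U (f : R[i] -> R[i]) : Prop :=
  forall z0, U z0 -> exists c : nat -> R[i],
    \forall z \near z0, cpseries c (z - z0) @ \oo --> f z.

(* L is an analytic branch on U of the logarithm of p; the corresponding branch
   of the r-th root of p is cexp (L z / r). *)
Definition log_branch U (p : {poly R[i]}) (L : R[i] -> R[i]) : Prop :=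
  analytic_on U L /\ (forall z, U z -> cexp (L z) = p.[z]).

(* \sum_n g_n x^n is the expansion of (w + v * p^(1/r)) / q. Non-vanishing of q
   on U makes the quotient well defined there (division in Rocq is total);
   p does not vanish on U since an exponential never does. *)
Definition is_expansion (r : R[i]) (p q v w : {poly R[i]}) g : Prop :=
  (0 < convergence_radius g)%E /\
  exists U : set R[i],
    [/\ U !=set0, open U, connected U & U `<=` convergence_disc g] /\
    exists L : R[i] -> R[i],
      log_branch U p L /\
      forall z, U z ->
        q.[z] != 0 /\
        cpseries g z @ \oo --> (w.[z] + v.[z] * cexp (L z / r)) / q.[z].

End PowerSeries.

Section Recurrence.
Variable K : comNzRingType.
Implicit Types (r : K) (p q v w P : {poly K}).

(* In particular deg 0 = 0. *)
Definition deg P : nat := (size P).-1.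

Definition recR r p q v : {poly K} := r *: (p * q * v).

Definition recQ r p q v : {poly K} :=
  r *: (p * (q^`() * v - q * v^`())) - v * p^`() * q.

Definition recH r p v w : {poly K} :=
  r *: (p * (w^`() * v - w * v^`())) - v * p^`() * w.

Definition ext0 (a : nat -> K) (k : int) : K :=
  if k is Posz m then a m else 0.

Definition coefz P (k : int) : K := ext0 (fun m => P`_m) k.

End Recurrence.

(* Main.v *)
(* Write y for the sum of g on the domain U of the branch and s = p^(1/r), so
   that q y = w + v s there and r p s' = p' s.  Differentiating and eliminating
   s gives R y' + Q y = H on U, and comparing coefficients in this equation is
   the recurrence.  As U need not contain 0, the equation between power series
   follows from its validity on U by an identity theorem, which rests on
   recentering a power series inside its disc of convergence through the
   binomial formula. *)

(* The branch lives on [U] only, so the root is never expanded at 0. What is expanded there is the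
   defect R g' + Q g - H, a power series whose sum is known to vanish on [U] alone. The index n of
   the recurrence belongs to coefficient n - 1 of the defect, and the sum over j can stop at deg R
   because every summand of Q contains a derivative of p, q or v. Coefficient n - 1 of H is zero for
   n - deg R > deg H as soon as deg R > 0; for deg R = 0 this bound still admits n - 1 = deg H,
   whence the extra hypothesis of the final theorem. *)
Require Import Defs.
From mathcomp Require Import all_boot all_order all_algebra.
From mathcomp Require Import complex.
From mathcomp Require Import all_classical all_reals all_analysis.
From mathcomp Require Import ring lra zify.
Set Implicit Arguments.
Unset Strict Implicit.
Unset Printing Implicit Defensive.
Import Order.TTheory GRing.Theory Num.Theory.
Import numFieldNormedType.Exports.
Local Open Scope classical_set_scope.
Local Open Scope ring_scope.

(** * The real-valued modulus and limits expressed through it *)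

Section Modulus.
Variable R : realType.
Local Notation C := R[i].
Implicit Types (x y z l : C) (u w : nat -> C).

Lemma modulusE z : real_complex R (modulus z) = `|z|.
Proof. by rewrite /modulus normc_def. Qed.

Lemma modulus_ge0 z : 0 <= modulus z.
Proof. by rewrite -ler0c modulusE. Qed.

Lemma modulus0 : modulus (0 : C) = 0.
Proof. by rewrite /modulus normr0. Qed.

Lemma modulus0_eq0 z : modulus z = 0 -> z = 0.
Proof. by move=> z0; apply/normr0_eq0; rewrite -modulusE z0. Qed.

Lemma modulusM x y : modulus (x * y) = modulus x * modulus y.
Proof. by apply: complexI; rewrite modulusE normrM rmorphM /= !modulusE. Qed.

Lemma modulus1 : modulus (1 : C) = 1.
Proof. by rewrite /modulus normr1. Qed.

Lemma modulusX z n : modulus (z ^+ n) = modulus z ^+ n.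
Proof. by elim: n => [|n IHn]; rewrite ?modulus1// !exprS modulusM IHn. Qed.

Lemma modulusN z : modulus (- z) = modulus z.
Proof. by rewrite /modulus normrN. Qed.

Lemma modulusD x y : modulus (x + y) <= modulus x + modulus y.
Proof. by rewrite -lecR rmorphD /= !modulusE ler_normD. Qed.

Lemma modulusB x y : modulus (x - y) <= modulus x + modulus y.
Proof. by rewrite -(modulusN y) modulusD. Qed.

Lemma modulus_sum (I : Type) (s : seq I) (P : pred I) (F : I -> C) :
  modulus (\sum_(i <- s | P i) F i) <= \sum_(i <- s | P i) modulus (F i).
Proof.
elim/big_ind2: _ => //; first by rewrite modulus0.
by move=> x a y b xa yb; rewrite (le_trans (modulusD _ _))// lerD.
Qed.

Lemma modulus_nat n : modulus (n%:R : C) = n%:R.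
Proof. by rewrite /modulus normr_nat -(rmorph_nat (real_complex R)). Qed.

Lemma modulus_real (t : R) : modulus (real_complex R t) = `|t|.
Proof. by rewrite /modulus normc_def /= expr0n addr0 sqrtr_sqr. Qed.

Lemma modulus_i : modulus ('i%C : C) = 1.
Proof. by rewrite /modulus normc_def /= expr0n add0r expr1n sqrtr1. Qed.

Lemma modulus_le_ReIm x : modulus x <= `|complex.Re x| + `|complex.Im x|.
Proof.
rewrite [in modulus x](complexE x) (le_trans (modulusD _ _))// modulusM.
by rewrite modulus_i mul1r !modulus_real.
Qed.

Lemma Re_le_modulus x : `|complex.Re x| <= modulus x.
Proof. by rewrite -lecR modulusE normc_ge_Re. Qed.

Lemma Im_le_modulus x : `|complex.Im x| <= modulus x.
Proof.
rewrite -normrN -ReiNIm (le_trans (Re_le_modulus _))//.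
by rewrite modulusM modulus_i mulr1.
Qed.

(** Moves limits in [R[i]] to the real line, where squeezing and order arguments are available. *)
Lemma cvg_modulusP u l :
  u @ \oo --> l <-> (fun n => modulus (u n - l)) @ \oo --> (0 : R).
Proof.
split => [/(@cvgrPdist_lt C C) ul|/cvgr0Pnorm_lt ul].
  apply/cvgr0Pnorm_lt => e e0; have := ul (real_complex R e).
  rewrite ltcR => /(_ e0); apply: filterS => n; rewrite distrC -modulusE ltcR.
  by rewrite (ger0_norm (modulus_ge0 _)).
(* The order of [R[i]] compares only numbers with equal imaginary parts, so a positive [e] is a
   positive real. *)
apply/(@cvgrPdist_lt C C) => e; rewrite ltcE /= => /andP[/eqP Ime Ree].
apply: filterS (ul _ Ree) => n; rewrite (ger0_norm (modulus_ge0 _)).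
by rewrite distrC -modulusE ltcE /= Ime eqxx.
Qed.

Lemma near_modulusP z (P : C -> Prop) :
  (\forall x \near z, P x) <->
  exists2 e : R, 0 < e & forall x, modulus (x - z) < e -> P x.
Proof.
split=> [/nbhs_normP[e /= ]|[e e0 eP]].
  rewrite ltcE /= => /andP[/eqP Ime Ree] eP.
  exists (complex.Re e) => // x xz; apply: eP; rewrite /= distrC -modulusE.
  by rewrite ltcE /= Ime eqxx.
apply/nbhs_normP; exists (real_complex R e); first by rewrite /= ltcR.
by move=> x /=; rewrite distrC -modulusE ltcR; exact: eP.
Qed.

End Modulus.

(** * Convergence and geometric bounds of complex series *)

Section PowerSeries.
Variable R : realType.
Local Notation C := R[i].
Implicit Types (a c u : nat -> C) (h l s x z : C).

Lemma cvgC_unique u l l' : u @ \oo --> l -> u @ \oo --> l' -> l = l'.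
Proof.
move=> /cvg_modulusP ul /cvg_modulusP ul'; apply/eqP; rewrite -subr_eq0.
apply/eqP/modulus0_eq0/eqP; rewrite eq_le modulus_ge0 andbT.
have /cvgr0Pnorm_lt ull :
    (fun n => modulus (u n - l) + modulus (u n - l')) @ \oo --> (0 : R).
  by rewrite -[0]addr0; exact: cvgD.
apply/ler_addgt0Pl => e e0; rewrite addr0.
have [n _ /(_ _ (leqnn n))/= ne] := ull _ e0.
apply: (le_trans _ (ltW (le_lt_trans (ler_norm _) ne))).
have -> : l - l' = (u n - l') - (u n - l) by ring.
by rewrite (le_trans (modulusB _ _))// addrC.
Qed.

Lemma cvg_modulus_le u l (b : R) N : u @ \oo --> l ->
  (forall n, (N <= n)%N -> modulus (u n) <= b) -> modulus l <= b.
Proof.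
move=> /cvg_modulusP/cvgr0Pnorm_lt ul ub; apply/ler_addgt0Pr => e e0.
have [n _ /(_ (maxn n N))/=] := ul _ e0; rewrite leq_maxl => /(_ isT) ne.
set m := maxn n N in ne *; have {1}-> : l = u m - (u m - l) by ring.
rewrite (le_trans (modulusB _ _))// lerD ?ub ?leq_maxr//.
exact: le_trans (ler_norm _) (ltW ne).
Qed.

(** Real and imaginary parts are dominated by the modulus, so both real series converge absolutely;
    their sums are the parts of the limit. *)
Lemma cvg_seriesC u : cvgn (series (fun n => modulus (u n))) ->
  exists l, series u @ \oo --> l.
Proof.
move=> cu.
have part (f : C -> R) : (forall x, `|f x| <= modulus x) ->
    cvgn (series (fun n => f (u n))).
  move=> fle; apply: normed_cvg; apply: series_le_cvg cu => n.
  - exact: normr_ge0.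
  - exact: modulus_ge0.
  - exact: fle.
have /cvg_ex[/= a ua] := part _ (@Re_le_modulus R).
have /cvg_ex[/= b ub] := part _ (@Im_le_modulus R).
exists (Complex a b); apply/cvg_modulusP.
set ru := series (fun n => complex.Re (u n)) in ua.
set iu := series (fun n => complex.Im (u n)) in ub.
have abs0 : (fun n => `|ru n - a| + `|iu n - b|) @ \oo --> (0 : R).
  rewrite -[0]addr0 -[X in X + _](normr0 R) -[X in _ + X](normr0 R).
  by apply: cvgD; apply: cvg_norm; [rewrite -(subrr a)|rewrite -(subrr b)];
    apply: cvgB => //; exact: cvg_cst.
apply: squeeze_cvgr (cvg_cst 0) abs0.
apply: nearW => n; rewrite modulus_ge0 /=.
have -> : ru n = complex.Re (series u n).
  rewrite /ru /series/=; elim/big_rec2: _ => // k x y _ ->.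
  by case: (u k) x => ? ? [].
have -> : iu n = complex.Im (series u n).
  rewrite /iu /series/=; elim/big_rec2: _ => // k x y _ ->.
  by case: (u k) x => ? ? [].
apply: le_trans (modulus_le_ReIm _) _; by case: (series u n).
Qed.

Section Geometric.
Variables (u : nat -> C) (M q : R).
Hypotheses (q_ge0 : 0 <= q) (q_lt1 : q < 1).
Hypothesis u_le : forall n, modulus (u n) <= M * q ^+ n.

Lemma cvg_geometric_bound : exists l, series u @ \oo --> l.
Proof.
have M_ge0 : 0 <= M.
  by rewrite (le_trans (modulus_ge0 (u 0%N)))// (le_trans (u_le _))// mulr1.
apply: cvg_seriesC; apply: (@series_le_cvg _ _ (geometric M q)) => // n.
- exact: modulus_ge0.
- exact: geometric_ge0.
- by apply: is_cvg_geometric_series; rewrite ger0_norm.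
Qed.

Lemma geometric_tail l K : series u @ \oo --> l ->
  modulus (l - series u K) <= M * q ^+ K / (1 - q).
Proof.
have M_ge0 : 0 <= M.
  by rewrite (le_trans (modulus_ge0 (u 0%N)))// (le_trans (u_le _))// mulr1.
move=> ul; apply: (@cvg_modulus_le (fun n => series u n - series u K) _ _ K).
  apply/cvg_modulusP; move/cvg_modulusP : ul.
  by under [in X in _ -> X]eq_fun do rewrite opprB addrA subrK.
move=> N KN; rewrite sub_series KN (le_trans (modulus_sum _ _ _))//.
apply: (@le_trans _ _ (\sum_(K <= k < N) M * q ^+ k)); first exact: ler_sum.
rewrite -mulr_sumr -mulrA ler_wpM2l// ler_pdivlMr ?subr_gt0//.
rewrite -(subnKC KN) geometric_partial_tail geometric_seriesE ?lt_eqF//=.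
rewrite mulrVK ?unitfE ?subr_eq0 1?eq_sym ?lt_eqF// ler_piMr ?exprn_ge0//.
by rewrite gerBl exprn_ge0.
Qed.

End Geometric.
End PowerSeries.

(** * Abel bounds and recentering of power series *)

Section Recentering.
Variable R : realType.
Local Notation C := R[i].
Implicit Types (a c u : nat -> C) (h l s x z : C) (rho : R).

(** Abel's condition, the working form of a radius of convergence: at every radius below [rho] it
    dominates the terms by a geometric series. *)
Definition terms_bounded a rho :=
  exists M : R, forall n, modulus (a n) * rho ^+ n <= M.

Lemma cvg_terms_bounded a z :
  cvgn (cpseries a z) -> terms_bounded a (modulus z).
Proof.
case/cvg_ex => /= l /cvg_modulusP sl.
have : cvgn (fun n => modulus (cpseries a z n - l)) by apply/cvg_ex; exists 0.
case/cvg_seq_bounded/bounded_fun_has_ubound => M /= ub.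
exists (M + M) => n; rewrite -modulusX -modulusM.
have -> : a n * z ^+ n = (cpseries a z n.+1 - l) - (cpseries a z n - l).
  by rewrite /cpseries seriesSr; ring.
by rewrite (le_trans (modulusB _ _))// lerD// ub//.
Qed.

Lemma terms_bounded_geometric a rho : 0 < rho -> terms_bounded a rho ->
  exists2 M : R, 0 <= M & forall n (t : R), 0 <= t ->
    modulus (a n) * t ^+ n <= M * (t / rho) ^+ n.
Proof.
move=> rho0 [M aM]; exists M => [|n t t0].
  by rewrite (le_trans _ (aM 0%N))// mulr1 modulus_ge0.
rewrite -[in leLHS](divfK (lt0r_neq0 rho0) t) exprMn mulrCA mulrC.
by rewrite ler_wpM2r ?exprn_ge0 ?divr_ge0 ?(ltW rho0).
Qed.

Lemma ratio_lt1 (t rho : R) : 0 <= t < rho -> 0 <= t / rho < 1.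
Proof.
move=> /andP[t0 trho]; have rho0 := le_lt_trans t0 trho.
by rewrite divr_ge0 ?(ltW rho0)//= ltr_pdivrMr// mul1r.
Qed.

Lemma cvg_cpseries a rho z : terms_bounded a rho -> modulus z < rho ->
  exists l, cpseries a z @ \oo --> l.
Proof.
move=> arho zrho; have rho0 := le_lt_trans (modulus_ge0 z) zrho.
have /andP[q0 q1] : 0 <= modulus z / rho < 1.
  by rewrite ratio_lt1// modulus_ge0.
have [M _ aM] := terms_bounded_geometric rho0 arho.
apply: (@cvg_geometric_bound _ _ M _ q0 q1) => n.
by rewrite modulusM modulusX aM ?modulus_ge0.
Qed.

(** Taylor remainder with a constant uniform in [h]. For |h| <= rho / 2 the geometric ratio is at
    most 1/2, so its factor 1 / (1 - ratio) is at most the 2 in the witness. *)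
Lemma cpseries_truncation c rho K : 0 < rho -> terms_bounded c rho ->
  exists B : R, forall h s, modulus h <= rho / 2 ->
    cpseries c h @ \oo --> s ->
    modulus (s - cpseries c h K) <= B * modulus h ^+ K.
Proof.
move=> rho0 /(terms_bounded_geometric rho0)[M M0 cM].
exists (2 * M / rho ^+ K) => h s hrho ch.
have q0 : 0 <= modulus h / rho by rewrite divr_ge0 ?modulus_ge0 ?ltW.
have q2 : modulus h / rho <= 2^-1 by rewrite ler_pdivrMr// mulrC.
have q1 : modulus h / rho < 1 by rewrite (le_lt_trans q2)// invf_lt1 ?ltr1n.
have uM n : modulus (c n * h ^+ n) <= M * (modulus h / rho) ^+ n.
  by rewrite modulusM modulusX cM ?modulus_ge0.
apply: le_trans (geometric_tail q0 q1 uM K ch) _.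
rewrite ler_pdivrMr ?subr_gt0// exprMn exprVn.
have -> : 2 * M / rho ^+ K * modulus h ^+ K * (1 - modulus h / rho) =
  M * (modulus h ^+ K / rho ^+ K) * (2 * (1 - modulus h / rho)) by ring.
rewrite ler_peMr ?mulr_ge0 ?invr_ge0 ?exprn_ge0 ?modulus_ge0 ?(ltW rho0)//.
by lra.
Qed.

Lemma modulus_small_eq0 x (B e : R) : 0 < e ->
  (forall t, 0 < t < e -> modulus x <= B * t) -> x = 0.
Proof.
move=> e0 xB; apply/modulus0_eq0/eqP; rewrite eq_le modulus_ge0 andbT.
apply/ler_addgt0Pr => d d0; rewrite add0r.
have B1 : 0 < `|B| + 1 by rewrite ltr_wpDl.
have t0 : 0 < Num.min (e / 2) (d / (`|B| + 1)).
  by rewrite lt_min !divr_gt0.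
apply: le_trans (xB (Num.min (e / 2) (d / (`|B| + 1))) _) _.
  by rewrite t0/= gt_min ltr_pdivrMr// ltr_pMr// ltr1n.
apply: (@le_trans _ _ ((`|B| + 1) * (d / (`|B| + 1)))).
  apply: (@le_trans _ _ ((`|B| + 1) * Num.min (e / 2) (d / (`|B| + 1)))).
    by rewrite ler_pM2r// (le_trans (ler_norm _))// lerDl.
  by rewrite ler_pM2l// ge_min lexx orbT.
by rewrite mulrC divfK ?lt0r_neq0.
Qed.

(** Once the coefficients below k vanish, truncation after the term of index k at a small real t
    gives |c_k| t^k <= B t^(k+1), hence |c_k| <= B t. *)
Lemma cpseries_eq0 c (e : R) : 0 < e ->
  (forall h, modulus h < e -> cpseries c h @ \oo --> (0 : C)) ->
  forall k, c k = 0.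
Proof.
move=> e0 c0; have e2 : 0 < e / 2 by rewrite divr_gt0.
have bc : terms_bounded c (e / 2).
  rewrite -[e / 2]gtr0_norm// -modulus_real; apply: cvg_terms_bounded.
  apply/cvg_ex; exists (0 : C); apply: c0.
  by rewrite modulus_real gtr0_norm// ltr_pdivrMr// ltr_pMr// ltr1n.
elim/ltn_ind => k IHk; have [B cB] := cpseries_truncation k.+1 e2 bc.
apply: (@modulus_small_eq0 _ B (e / 2 / 2)); first by rewrite divr_gt0.
move=> t /andP[t0 te]; have := cB (real_complex R t) 0.
rewrite modulus_real gtr0_norm// (ltW te) => /(_ isT).
have te' : modulus (real_complex R t) < e.
  rewrite modulus_real gtr0_norm// (lt_trans te)// -mulrA.
  by rewrite gtr_pMr// -invfM invf_lt1// -natrM ltr1n.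
move=> /(_ (c0 _ te')); rewrite /cpseries seriesSr sub0r modulusN.
rewrite /series/= big_nat big1 ?add0r => [|j /andP[_ jk]]; last first.
  by rewrite IHk// mul0r.
rewrite modulusM modulusX modulus_real gtr0_norm// exprS mulrA.
by rewrite ler_pM2r// exprn_gt0.
Qed.

Lemma bin_term_le (x y : R) n k : 0 <= x -> 0 <= y ->
  x ^+ (n - k) * y ^+ k *+ 'C(n, k) <= (x + y) ^+ n.
Proof.
move=> x0 y0; have [kn|nk] := leqP k n; last first.
  by rewrite bin_small// exprn_ge0 ?addr_ge0.
rewrite exprDn (bigD1 (Ordinal (kn : (k < n.+1)%N)))//= lerDl sumr_ge0// => i _.
by rewrite mulrn_wge0// mulr_ge0// exprn_ge0.
Qed.

(** The coefficient of h^k in a_n (z + h)^n. For n < k the truncated exponent is harmless since the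
    binomial is 0. *)
Definition recenter_term a z k : nat -> C :=
  fun n => a n * (z ^+ (n - k) *+ 'C(n, k)).

Lemma recenter_coef a rho z : terms_bounded a rho -> modulus z < rho ->
  exists c, forall k, series (recenter_term a z k) @ \oo --> c k.
Proof.
move=> arho zrho; have rho0 := le_lt_trans (modulus_ge0 z) zrho.
have [M M0 aM] := terms_bounded_geometric rho0 arho.
(* A slack spent on the binomial: |z|^(n-k) t^k 'C(n, k) <= (|z| + t)^n with |z| + t < rho, so
   dividing by t^k leaves a geometric bound in n. *)
pose t := (rho - modulus z) / 2.
have t0 : 0 < t by rewrite divr_gt0// subr_gt0.
have zt0 : 0 <= modulus z + t by rewrite addr_ge0 ?modulus_ge0 ?ltW.
have /andP[q0 q1] : 0 <= (modulus z + t) / rho < 1.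
  by rewrite ratio_lt1// zt0/= /t; lra.
suff /choice[c cP] : forall k, exists l,
    series (recenter_term a z k) @ \oo --> l.
  by exists c.
move=> k; apply: (@cvg_geometric_bound _ _ (M / t ^+ k) _ q0 q1) => n.
rewrite mulrAC ler_pdivlMr ?exprn_gt0// (le_trans _ (aM n _ zt0))//.
rewrite modulusM -mulrA ler_wpM2l ?modulus_ge0//.
rewrite -mulr_natr modulusM modulusX modulus_nat mulrAC mulr_natr.
by rewrite bin_term_le ?modulus_ge0 ?ltW.
Qed.

Lemma cvgC_add u (v : nat -> C) l s : u @ \oo --> l -> v @ \oo --> s ->
  (fun n => u n + v n) @ \oo --> l + s.
Proof. exact: (@cvgD C C). Qed.

Lemma cvgC_mulr u l x : u @ \oo --> l -> (fun n => u n * x) @ \oo --> l * x.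
Proof. move=> ul. exact: (@cvgM C _ _ _ _ _ _ _ ul (cvg_cst x)). Qed.

Lemma cvgC_sum n (u : nat -> nat -> C) (l : nat -> C) :
  (forall k, u k @ \oo --> l k) ->
  (fun N => \sum_(k < n) u k N) @ \oo --> \sum_(k < n) l k.
Proof.
move=> ul; elim: n => [|n IHn].
  by under eq_fun do rewrite big_ord0; rewrite big_ord0; exact: cvg_cst.
have -> : \sum_(k < n.+1) l k = \sum_(k < n) l k + l n by rewrite big_ord_recr.
have -> : (fun N => \sum_(k < n.+1) u k N) =
    fun N => \sum_(k < n) u k N + u n N.
  by apply/funext => N; rewrite big_ord_recr.
exact: (cvgC_add IHn (ul n)).
Qed.

(** Exchanging two infinite sums is avoided: only the first K powers of h are split off, a finite
    sum, and the rest is bounded uniformly in K. *)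
Lemma recenterP a c rho z h s : terms_bounded a rho ->
  modulus z + modulus h < rho ->
  (forall k, series (recenter_term a z k) @ \oo --> c k) ->
  cpseries a (z + h) @ \oo --> s -> cpseries c h @ \oo --> s.
Proof.
move=> arho zhrho ac sa; set t := modulus z + modulus h in zhrho.
have t0 : 0 <= t by rewrite addr_ge0 ?modulus_ge0.
have [M M0 aM] := terms_bounded_geometric (le_lt_trans t0 zhrho) arho.
have /andP[q0 q1] : 0 <= t / rho < 1 by rewrite ratio_lt1// t0.
pose T n k := z ^+ (n - k) * h ^+ k *+ 'C(n, k).
have zhE n K : (n < K)%N -> (z + h) ^+ n = \sum_(k < K) T n k.
  move=> nK; rewrite exprDn (big_ord_widen _ (T n) nK).
  rewrite [RHS](bigID (fun k : 'I_K => (k < n.+1)%N))/=.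
  rewrite [X in _ + X]big1 ?addr0// => k; rewrite -leqNgt => nk.
  by rewrite /T bin_small.
(* What the first K binomial terms miss. It is 0 for n < K, so its sum over n is a geometric tail
   starting at K and tends to 0 with growing K. *)
pose u K n := a n * ((z + h) ^+ n - \sum_(k < K) T n k).
have u_le K n : modulus (u K n) <= M * (t / rho) ^+ n.
  rewrite modulusM (le_trans _ (aM n _ t0))// ler_wpM2l ?modulus_ge0//.
  have [nK|Kn] := ltnP n K.
    by rewrite (zhE n K)// subrr modulus0 exprn_ge0.
  rewrite (zhE n n.+1)// (big_ord_widen _ (T n) (leqW Kn)).
  rewrite (bigID (fun k : 'I_n.+1 => (k < K)%N))/= addrAC subrr add0r.
  rewrite (le_trans (modulus_sum _ _ _))// /t exprDn.
  rewrite [leRHS](bigID (fun k : 'I_n.+1 => (k < K)%N))/=.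
  rewrite ler_wpDl ?sumr_ge0// => [k _|].
    by rewrite mulrn_wge0// mulr_ge0// exprn_ge0// modulus_ge0.
  apply: ler_sum => k _; rewrite /T -mulr_natr 2!modulusM !modulusX modulus_nat.
  by rewrite mulr_natr.
have u_cvg K : series (u K) @ \oo --> s - cpseries c h K.
  have cK : (fun N => \sum_(k < K) series (recenter_term a z k) N * h ^+ k)
      @ \oo --> cpseries c h K.
    rewrite /cpseries seriesEord.
    apply: (@cvgC_sum K (fun k N => series (recenter_term a z k) N * h ^+ k)
      (fun k => c k * h ^+ k)) => k.
    exact: (@cvgC_mulr _ _ (h ^+ k) (ac k)).
  have -> : series (u K) = fun N => cpseries a (z + h) N +
      (\sum_(k < K) series (recenter_term a z k) N * h ^+ k) * -1.
    apply/funext => N; rewrite mulrN1 /cpseries /series/=.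
    under [X in _ - X]eq_bigr do rewrite mulr_suml.
    rewrite exchange_big/= -sumrB; apply: eq_bigr => n _.
    rewrite /u mulrBr; congr (_ - _); rewrite mulr_sumr; apply: eq_bigr => k _.
    by rewrite /recenter_term /T -mulrA mulrnAl.
  rewrite -[- cpseries c h K]mulrN1.
  exact: (cvgC_add sa (@cvgC_mulr _ _ (-1) cK)).
have trunc K :
    modulus (cpseries c h K - s) <= M / (1 - t / rho) * (t / rho) ^+ K.
  rewrite -modulusN opprB mulrAC.
  apply: le_trans (geometric_tail q0 q1 (u_le K) K (u_cvg K)).
  rewrite /series/= big_nat big1 ?subr0// => n /andP[_ nK].
  by rewrite /u (zhE n K)// subrr mulr0.
apply/cvg_modulusP; apply: squeeze_cvgr (cvg_cst 0) (cvg_geometric _ _).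
  by apply: nearW => K; rewrite modulus_ge0/=; exact: trunc.
by rewrite ger0_norm.
Qed.

End Recentering.

(** * The identity theorem *)

Section Identity.
Variable R : realType.
Local Notation C := R[i].
Implicit Types (a c : nat -> C) (h l s x z : C) (rho : R).

(** Recentered at z, the series vanishes near 0, so all its coefficients are 0; it still represents
    the sum of [a] on the whole disc of radius rho - |z|. *)
Lemma cpseries_vanish_ball a rho z h (e : R) : terms_bounded a rho ->
  modulus z + modulus h < rho -> 0 < e ->
  (forall k, modulus k < e -> cpseries a (z + k) @ \oo --> (0 : C)) ->
  cpseries a (z + h) @ \oo --> (0 : C).
Proof.
move=> arho zhrho e0 a0.
have zrho : modulus z < rho.
  by rewrite (le_lt_trans _ zhrho)// lerDl modulus_ge0.
have [c ac] := recenter_coef arho zrho.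
have c0 : forall k, c k = 0.
  apply: (@cpseries_eq0 _ _ (Num.min e (rho - modulus z))).
    by rewrite lt_min e0 subr_gt0.
  move=> k; rewrite lt_min ltrBrDl => /andP[ke krho].
  exact: (recenterP arho krho ac (a0 _ ke)).
have [s sa] := cvg_cpseries arho (le_lt_trans (modulusD z h) zhrho).
have := recenterP arho zhrho ac sa.
have -> : cpseries c h = fun=> 0.
  apply/funext => n; rewrite /cpseries /series/= big1// => k _.
  by rewrite c0 mul0r.
by move=> /(cvgC_unique (cvg_cst (0 : C))) ->.
Qed.

(* The radius rho - |z| of the disc to which vanishing near z propagates stays
   bounded below as z moves along the segment from z0 to 0, so finitely many
   steps of length |z0| / m reach the origin. *)
Lemma cpseries_identity a rho z0 (e : R) : terms_bounded a rho ->
  modulus z0 < rho -> 0 < e ->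
  (forall h, modulus h < e -> cpseries a (z0 + h) @ \oo --> (0 : C)) ->
  forall n, a n = 0.
Proof.
move=> arho z0rho e0 a0; pose d := (rho - modulus z0) / 2.
have d0 : 0 < d by rewrite divr_gt0 ?subr_gt0.
have [m m0 md] : exists2 m, (0 < m)%N & modulus z0 / m%:R <= d.
  exists (Num.truncn (modulus z0 / d)).+1 => //.
  rewrite ler_pdivrMr ?ltr0n// mulrC -ler_pdivrMr//.
  by rewrite ltW// truncnS_gt.
have mR0 : 0 < m%:R :> R by rewrite ltr0n.
have mC0 : m%:R != 0 :> C by rewrite pnatr_eq0 -lt0n.
(* The centres run from [z0] at j = 0 to the origin at j = m. *)
pose z j : C := z0 * ((m - j)%:R / m%:R).
have zz0 j : modulus (z j) <= modulus z0.
  rewrite modulusM ler_piMr ?modulus_ge0//.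
  have -> : (m - j)%:R / m%:R = real_complex R ((m - j)%:R / m%:R).
    by rewrite rmorphM fmorphV !rmorph_nat.
  rewrite modulus_real ger0_norm ?divr_ge0// ler_pdivrMr// mul1r ler_nat.
  exact: leq_subr.
suff near_z : forall j, (j <= m)%N ->
    exists2 e : R, 0 < e & forall h, modulus h < e ->
      cpseries a (z j + h) @ \oo --> (0 : C).
  have [e' e'0 a0'] := near_z m (leqnn m); apply: (cpseries_eq0 e'0) => h he'.
  by have := a0' h he'; rewrite /z subnn mul0r mulr0 add0r.
elim=> [|j IHj] jm.
  by exists e => // h he; rewrite /z subn0 divff// mulr1; exact: a0.
have [e' e'0 a0'] := IHj (ltnW jm); exists d => // h hd.
have -> : z j.+1 + h = z j + (h - z0 / m%:R).
  by rewrite /z -(subnSK jm) -natr1; field.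
apply: cpseries_vanish_ball arho _ e'0 a0'.
apply: le_lt_trans (lerD (zz0 j) (modulusB _ _)) _.
have -> : modulus (z0 / m%:R) = modulus z0 / m%:R.
  have -> : z0 / m%:R = z0 * real_complex R m%:R^-1.
    by rewrite fmorphV rmorph_nat.
  by rewrite modulusM modulus_real ger0_norm// invr_ge0 ltW.
by move: md hd; rewrite /d; lra.
Qed.

End Identity.

(** * Complex derivatives with quadratic error *)

Section ComplexDerivative.
Variable R : realType.
Local Notation C := R[i].
Implicit Types (f g phi psi : C -> C) (a b d h l x z : C).

Definition bounded_near0 phi := exists B e : R,
  0 < e /\ forall h, modulus h < e -> modulus (phi h) <= B.

Lemma bounded_near0_cst a : bounded_near0 (fun=> a).
Proof. by exists (modulus a), 1. Qed.

Lemma bounded_near0_id : bounded_near0 (fun h => h).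
Proof. by exists 1, 1; split=> // h /ltW. Qed.

Lemma bounded_near0D phi psi : bounded_near0 phi -> bounded_near0 psi ->
  bounded_near0 (fun h => phi h + psi h).
Proof.
move=> [B [e [e0 phiB]]] [B' [e' [e'0 psiB]]].
exists (B + B'), (Num.min e e'); rewrite lt_min e0; split=> // h.
rewrite lt_min => /andP[he he']; rewrite (le_trans (modulusD _ _))//.
by rewrite lerD ?phiB ?psiB.
Qed.

Lemma bounded_near0M phi psi : bounded_near0 phi -> bounded_near0 psi ->
  bounded_near0 (fun h => phi h * psi h).
Proof.
move=> [B [e [e0 phiB]]] [B' [e' [e'0 psiB]]].
exists (B * B'), (Num.min e e'); rewrite lt_min e0; split=> // h.
rewrite lt_min => /andP[he he']; rewrite modulusM.
by rewrite ler_pM ?modulus_ge0 ?phiB ?psiB.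
Qed.

Lemma bounded_near0_comp phi psi : bounded_near0 phi -> bounded_near0 psi ->
  bounded_near0 (fun h => phi (h * psi h)).
Proof.
move=> [B [e [e0 phiB]]] [B' [e' [e'0 psiB]]].
have B'0 : 0 < `|B'| + 1 by rewrite ltr_wpDl.
exists B, (Num.min e' (e / (`|B'| + 1))).
rewrite lt_min e'0 divr_gt0//; split=> // h.
rewrite lt_min => /andP[he']; rewrite ltr_pdivlMr// => he.
apply: phiB; rewrite modulusM; apply: le_lt_trans he.
rewrite ler_wpM2l ?modulus_ge0// (le_trans (psiB _ he'))//.
by rewrite (le_trans (ler_norm _))// lerDl.
Qed.

(* Requiring an O(h^2) error, as analytic functions have, keeps the chain rule
   and the termwise differentiation elementary. *)
Definition has_deriv f z d := exists phi,
  bounded_near0 phi /\ forall h, f (z + h) = f z + d * h + phi h * h ^+ 2.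

Lemma has_deriv_cst a z : has_deriv (fun=> a) z 0.
Proof.
by exists (fun=> 0); split=> [|h]; [exact: bounded_near0_cst|ring].
Qed.

Lemma has_deriv_id z : has_deriv (fun x => x) z 1.
Proof.
by exists (fun=> 0); split=> [|h]; [exact: bounded_near0_cst|ring].
Qed.

Lemma has_derivD f g z a b : has_deriv f z a -> has_deriv g z b ->
  has_deriv (fun x => f x + g x) z (a + b).
Proof.
move=> [phi [bphi fE]] [psi [bpsi gE]]; exists (fun h => phi h + psi h).
by split=> [|h]; [exact: bounded_near0D|rewrite fE gE; ring].
Qed.

Lemma has_derivM f g z a b : has_deriv f z a -> has_deriv g z b ->
  has_deriv (fun x => f x * g x) z (a * g z + f z * b).
Proof.
move=> [phi [bphi fE]] [psi [bpsi gE]].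
exists (fun h => f z * psi h + phi h * g z + a * b
  + (a * psi h + phi h * b) * h + phi h * psi h * (h * h)).
split=> [|h]; last by rewrite fE gE; ring.
by repeat first [apply: bounded_near0D | apply: bounded_near0M
  | exact: bounded_near0_cst | exact: bounded_near0_id | assumption].
Qed.

Lemma has_deriv_comp f g z a b : has_deriv f z a -> has_deriv g (f z) b ->
  has_deriv (fun x => g (f x)) z (b * a).
Proof.
move=> [phi [bphi fE]] [psi [bpsi gE]]; pose k h := a + phi h * h.
have bk : bounded_near0 k.
  apply: bounded_near0D; first exact: bounded_near0_cst.
  by apply: bounded_near0M => //; exact: bounded_near0_id.
exists (fun h => b * phi h + psi (h * k h) * (k h * k h)); split=> [|h].
  apply: bounded_near0D; apply: bounded_near0M => //.
  - exact: bounded_near0_cst.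
  - exact: bounded_near0_comp.
  - exact: bounded_near0M.
have -> : f (z + h) = f z + h * k h by rewrite fE /k; ring.
by rewrite gE /k; ring.
Qed.

Lemma has_deriv_horner (p : {poly C}) z : has_deriv (horner p) z p^`().[z].
Proof.
elim/poly_ind: p => [|p c IHp].
  rewrite deriv0 horner0.
  have -> : horner (0 : {poly C}) = fun=> 0.
    by apply/funext => x; rewrite horner0.
  exact: has_deriv_cst.
have -> : horner (p * 'X + c%:P) = fun x => p.[x] * x + c.
  by apply/funext => x; rewrite !hornerE.
have -> : (p * 'X + c%:P)^`().[z] = p^`().[z] * z + p.[z] * 1 + 0.
  by rewrite derivD derivM derivX derivC !hornerE.
apply: has_derivD; last exact: has_deriv_cst.
by apply: has_derivM => //; exact: has_deriv_id.
Qed.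

(** [has_deriv] wants an exact expansion for every [h], so the error is divided by h^2 everywhere;
    at [h = 0] division yields 0 and the expansion is trivial. *)
Lemma has_deriv_near f z d (B e : R) : 0 < e ->
  (forall h, modulus h < e ->
     modulus (f (z + h) - (f z + d * h)) <= B * modulus h ^+ 2) ->
  has_deriv f z d.
Proof.
move=> e0 fB; exists (fun h => (f (z + h) - (f z + d * h)) / h ^+ 2).
split=> [|h].
  exists `|B|, e; split=> // h he; have [->|h0] := eqVneq h 0.
    by rewrite expr0n invr0 mulr0 modulus0.
  have mh0 : 0 < modulus h.
    rewrite lt_def modulus_ge0 andbT; apply: contra h0 => /eqP h0.
    exact/eqP/modulus0_eq0.
  rewrite -(@ler_pM2r _ (modulus h ^+ 2)) ?exprn_gt0//.
  rewrite -modulusX -modulusM divfK ?expf_neq0// (le_trans (fB _ he))//.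
  by rewrite modulusX ler_wpM2r ?exprn_ge0 ?modulus_ge0 ?ler_norm.
have [->|h0] := eqVneq h 0; first by rewrite !addr0 expr0n !mulr0 !addr0.
by rewrite divfK ?expf_neq0//; ring.
Qed.

Lemma near_eq_has_deriv f g z a (e : R) : 0 < e ->
  (forall h, modulus h < e -> f (z + h) = g (z + h)) ->
  has_deriv f z a -> has_deriv g z a.
Proof.
move=> e0 fg [phi [[B [e' [e'0 phiB]]] fE]].
have fz : f z = g z by rewrite -[z]addr0 fg// modulus0.
apply: (@has_deriv_near _ _ _ B (Num.min e e')); first by rewrite lt_min e0.
move=> h; rewrite lt_min => /andP[he he']; rewrite -fg// -fz fE addrC addrA.
by rewrite addNr add0r modulusM modulusX ler_wpM2r
  ?exprn_ge0 ?modulus_ge0 ?phiB.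
Qed.

Lemma has_deriv_unique f z a b : has_deriv f z a -> has_deriv f z b -> a = b.
Proof.
move=> [phi [bphi fE]] [psi [bpsi fE']].
have [B [e [e0 chiB]]] :=
  bounded_near0D bpsi (bounded_near0M (bounded_near0_cst (-1)) bphi).
apply/eqP; rewrite -subr_eq0; apply/eqP/(@modulus_small_eq0 _ _ B e) => // t.
move=> /andP[t0 te]; pose h := real_complex R t.
have ht : modulus h = t by rewrite modulus_real gtr0_norm.
have h0 : h != 0 by apply/eqP => h0; move: t0; rewrite -ht h0 modulus0 ltxx.
have -> : a - b = (psi h + -1 * phi h) * h.
  have /eqP : f z + a * h + phi h * h ^+ 2 = f z + b * h + psi h * h ^+ 2.
    by rewrite -fE -fE'.
  rewrite -subr_eq0 => /eqP E; apply: (mulIf h0); apply/eqP.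
  by rewrite -subr_eq0; apply/eqP; rewrite -[RHS]E; ring.
by rewrite modulusM ht ler_pM2r// chiB// ht.
Qed.

Lemma has_deriv_cpseries f c z (e : R) : 0 < e ->
  (forall h, modulus h < e -> cpseries c h @ \oo --> f (z + h)) ->
  has_deriv f z (c 1%N).
Proof.
move=> e0 cf; have e2 : 0 < e / 2 by rewrite divr_gt0.
have e2e : e / 2 < e by rewrite ltr_pdivrMr// ltr_pMr// ltr1n.
have bc : terms_bounded c (e / 2).
  rewrite -[e / 2]gtr0_norm// -modulus_real; apply: cvg_terms_bounded.
  apply/cvg_ex; eexists; apply: cf; by rewrite modulus_real gtr0_norm.
have e4 : e / 2 / 2 < e.
  by rewrite (lt_trans _ e2e)// ltr_pdivrMr// ltr_pMr// ltr1n.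
(* Two terms are kept: c_0 + c_1 h, with an error of order h^2. *)
have [B cB] := cpseries_truncation 2 e2 bc.
apply: (@has_deriv_near _ _ _ B (e / 2 / 2)); first by rewrite divr_gt0.
have fz : f z = c 0%N.
  have := cf 0; rewrite modulus0 addr0 => /(_ e0)/cvgC_unique; apply.
  have -> : cpseries c 0 = fun n => c 0%N * (0 < n)%:R.
    apply/funext => -[|n]; rewrite /cpseries seriesEord/= ?big_ord0 ?mulr0//.
    rewrite big_ord_recl expr0 big1 ?addr0// => i _.
    by rewrite lift0 exprS mul0r mulr0.
  apply/cvg_modulusP; rewrite -(@cvg_shiftn 1); apply: cvg_near_cst.
  by apply: nearW => n /=; rewrite addn1 mulr1 subrr modulus0.
move=> h he; have := cB h _ (ltW he) (cf h (lt_trans he e4)).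
rewrite /cpseries !seriesSr /series/= big_geq// add0r expr0 expr1 mulr1.
by rewrite fz.
Qed.

End ComplexDerivative.

(** Here l is L', so s' = s l / r. The product Y = v s solves r p v Y' = (r p v' + p' v) Y, and
    putting Y = q y - w into this linear equation produces R, Q and H. *)
Lemma ode_identity (K : fieldType) (r p p' q q' v v' w w' y y' s l : K) :
  r != 0 -> l * p = p' -> q * y = w + v * s ->
  q' * y + q * y' = w' + (v' * s + v * (s * (l * r^-1))) ->
  r * (p * q * v) * y'
    + (r * (p * (q' * v - q * v')) - v * p' * q) * y
    + (r * (p * (w' * v - w * v')) - v * p' * w) * -1 = 0.
Proof.
move=> r0 <- qy qy'.
rewrite (_ : _ + _ + _ = r * p * v * (q' * y + q * y' - w')
  - (r * p * v' + v * (l * p)) * (q * y - w)); last by ring.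
by rewrite qy qy'; field.
Qed.

(** * The differential equation, on [U] and then between coefficients *)

Section DifferentialEquation.
Variable R : realType.
Local Notation C := R[i].
Implicit Types (a g : nat -> C) (p q v w P : {poly C}) (f L : C -> C).
Implicit Types (U : set C) (d h l r s x z : C) (rho : R).

Definition termwise_deriv a n : C := n.+1%:R * a n.+1.

(** After recentering at z the derivative is the coefficient of index 1, which the binomial formula
    gives as the sum of n a_n z^(n-1). *)
Lemma has_deriv_termwise a rho f z : terms_bounded a rho -> modulus z < rho ->
  (forall x, modulus x < rho -> cpseries a x @ \oo --> f x) ->
  exists2 d, cpseries (termwise_deriv a) z @ \oo --> d & has_deriv f z d.
Proof.
move=> arho zrho af; have [c ac] := recenter_coef arho zrho; exists (c 1%N).
  suff -> : cpseries (termwise_deriv a) z =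
      fun n => series (recenter_term a z 1) (n + 1)%N.
    by rewrite (cvg_shiftn 1); exact: ac.
  apply/funext => n; rewrite /cpseries !seriesEord addn1 /= big_ord_recl.
  rewrite /recenter_term bin0n mulr0n mulr0 add0r; apply: eq_bigr => k _.
  by rewrite lift0 subn1/= bin1 /termwise_deriv -mulr_natl; ring.
apply: (@has_deriv_cpseries _ _ _ _ (rho - modulus z)).
  by rewrite subr_gt0.
move=> h; rewrite ltrBrDl => zhrho; apply: (recenterP arho zhrho ac).
exact/af/(le_lt_trans (modulusD _ _)).
Qed.

Let exp_coef n : C := n`!%:R^-1.

Lemma exp_coef_bounded rho : terms_bounded exp_coef rho.
Proof.
have : cvgn (exp_coeff rho).
  apply/cvg_ex; exists 0; apply: cvg_series_cvg_0.
  exact: is_cvg_series_exp_coeff.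
case/cvg_seq_bounded/bounded_fun_has_ubound => M ub; exists M => n.
have -> : exp_coef n = real_complex R n`!%:R^-1 by rewrite fmorphV rmorph_nat.
by rewrite modulus_real ger0_norm ?invr_ge0// mulrC; apply: ub; exists n.
Qed.

Lemma cvg_cexp z : cpseries exp_coef z @ \oo --> cexp z.
Proof.
have [l el] := cvg_cpseries (exp_coef_bounded (modulus z + 1))
  (ltr_pwDr ltr01 (lexx (modulus z))).
by have : cvgn (cpseries exp_coef z) by apply/cvg_ex; exists l.
Qed.

Lemma has_deriv_cexp z : has_deriv (@cexp R) z (cexp z).
Proof.
have [d ed eE] := has_deriv_termwise (exp_coef_bounded (modulus z + 1))
  (ltr_pwDr ltr01 (lexx (modulus z))) (fun x _ => @cvg_cexp x).
have coefE : termwise_deriv exp_coef = exp_coef.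
  apply/funext => n; rewrite /termwise_deriv /exp_coef factS natrM invfM.
  by rewrite mulVKf.
by rewrite coefE in ed; rewrite (cvgC_unique (@cvg_cexp z) ed).
Qed.

(** Near z the function exp(L) is p, so uniqueness of the derivative gives p' = exp(L) L' = p L'. *)
Lemma log_branch_deriv U p L z : open U -> U z -> log_branch U p L ->
  exists2 l, has_deriv L z l & l * p.[z] = p^`().[z].
Proof.
move=> Uo Uz [Lan Lp]; have [c /near_modulusP[e e0 cL]] := Lan _ Uz.
have dL : has_deriv L z (c 1%N).
  apply: (has_deriv_cpseries e0) => h he.
  have := cL (z + h); rewrite (_ : z + h - z = h); last by ring.
  exact.
exists (c 1%N) => //.
have /near_modulusP[e' e'0 eU] : \forall x \near z, U x.
  exact: open_nbhs_nbhs.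
have dp : has_deriv (horner p) z (cexp (L z) * c 1%N).
  apply: near_eq_has_deriv e'0 _ (has_deriv_comp dL (has_deriv_cexp _)).
  by move=> h he; rewrite Lp//; apply: eU; rewrite (_ : z + h - z = h)//; ring.
by rewrite (has_deriv_unique (has_deriv_horner p z) dp) Lp// mulrC.
Qed.

Definition convolve P a n := \sum_(j < n.+1) P`_j * a (n - j)%N.

(** One factor is a polynomial, so Horner induction suffices: multiplication by X merely shifts the
    coefficients. *)
Lemma cvg_convolve P a x s : cpseries a x @ \oo --> s ->
  cpseries (convolve P a) x @ \oo --> P.[x] * s.
Proof.
move=> as_; elim/poly_ind: P => [|P c IHP].
  rewrite horner0 mul0r; have -> : cpseries (convolve 0 a) x = fun=> 0.
    apply/funext => n; rewrite /cpseries /series/= big1// => k _.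
    by rewrite /convolve big1 ?mul0r// => j _; rewrite coef0 mul0r.
  exact: cvg_cst.
have c0 : convolve (P * 'X + c%:P) a 0 = c * a 0%N.
  by rewrite /convolve big_ord1 coefD coefMX coefC add0r.
have cS n : convolve (P * 'X + c%:P) a n.+1 = convolve P a n + c * a n.+1.
  rewrite /convolve big_ord_recl coefD coefMX coefC add0r subn0 addrC.
  congr (_ + _); apply: eq_bigr => k _.
  by rewrite lift0 coefD coefMX coefC addr0 subSS.
rewrite hornerMXaddC -(@cvg_shiftS C).
have -> : (fun n => cpseries (convolve (P * 'X + c%:P) a) x n.+1) =
    fun n => cpseries (convolve P a) x n * x + cpseries a x n.+1 * c.
  apply/funext => n; rewrite /cpseries /series/= !big_nat_recl// c0.
  rewrite mulrDl addrCA !mulr_suml expr0 !mulr1 mulrC; congr (_ + _).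
  by rewrite -big_split/=; apply: eq_bigr => k _; rewrite cS exprS; ring.
have -> : (P.[x] * x + c) * s = P.[x] * s * x + s * c by ring.
apply: cvgC_add; first exact: (@cvgC_mulr _ _ _ x IHP).
have as1 := as_; rewrite -(@cvg_shiftS C) in as1.
exact: (@cvgC_mulr _ _ _ c as1).
Qed.

Lemma cvg_horner P x : cpseries (fun n => P`_n) x @ \oo --> P.[x].
Proof.
apply: cvg_near_cst; exists (size P) => // n /= Pn.
by rewrite /cpseries seriesEord (horner_coef_wide _ Pn).
Qed.

Lemma expansion_ode r p q v w g n : r != 0 -> is_expansion r p q v w g ->
  convolve (recR r p q v) (termwise_deriv g) n + convolve (recQ r p q v) g n =
  (recH r p v w)`_n.
Proof.
move=> r0 [_ [U [[[z0 Uz0] Uo _ Udisc] [L [Lbr gU]]]]].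
(* A point of convergence farther out than [z0]; its modulus serves as the working radius. *)
have [_ /= [z1 gz1 <-]] := ereal_sup_gt (Udisc _ Uz0); rewrite lte_fin => z01.
set rho := modulus z1 in z01.
have grho : terms_bounded g rho by exact: cvg_terms_bounded.
pose G x := limn (cpseries g x).
have gG x : modulus x < rho -> cpseries g x @ \oo --> G x.
  move=> /(cvg_cpseries grho)[l gl].
  by have : cvgn (cpseries g x) by apply/cvg_ex; exists l.
pose F n := convolve (recR r p q v) (termwise_deriv g) n
  + convolve (recQ r p q v) g n + (recH r p v w)`_n * -1.
have FE x d : modulus x < rho -> cpseries (termwise_deriv g) x @ \oo --> d ->
    cpseries F x @ \oo --> (recR r p q v).[x] * d + (recQ r p q v).[x] * G x
      + (recH r p v w).[x] * -1.
  move=> xrho gd.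
  have -> : cpseries F x = fun n =>
      cpseries (convolve (recR r p q v) (termwise_deriv g)) x n
      + cpseries (convolve (recQ r p q v) g) x n
      + cpseries (fun n => (recH r p v w)`_n) x n * -1.
    apply/funext => m; rewrite /cpseries /series/= mulr_suml -!big_split/=.
    by apply: eq_bigr => k _; rewrite /F; ring.
  have cRQ := cvgC_add (@cvg_convolve (recR r p q v) _ _ _ gd)
    (@cvg_convolve (recQ r p q v) _ _ _ (gG _ xrho)).
  exact: (cvgC_add cRQ (@cvgC_mulr _ _ _ (-1) (@cvg_horner (recH r p v w) x))).
have F0 x : U x -> modulus x < rho -> cpseries F x @ \oo --> (0 : C).
  move=> Ux xrho; have [d gd dG] := has_deriv_termwise grho xrho gG.
  have [l dL lp] := log_branch_deriv Uo Ux Lbr.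
  have /near_modulusP[e e0 eU] : \forall y \near x, U y.
    exact: open_nbhs_nbhs.
  have qG y : U y -> modulus y < rho ->
      q.[y] * G y = w.[y] + v.[y] * cexp (L y * r^-1).
    move=> /gU[qy0 gy] /gG/(cvgC_unique gy) <-.
    by rewrite mulrC divfK.
  have dqG := has_derivM (has_deriv_horner q x) dG.
  have dLr := has_derivM dL (has_deriv_cst r^-1 x).
  have dwv := has_derivD (has_deriv_horner w x)
    (has_derivM (has_deriv_horner v x) (has_deriv_comp dLr (has_deriv_cexp _))).
  have e'0 : 0 < Num.min e (rho - modulus x) by rewrite lt_min e0 subr_gt0.
  have qGnear h : modulus h < Num.min e (rho - modulus x) ->
      q.[x + h] * G (x + h) = w.[x + h] + v.[x + h] * cexp (L (x + h) * r^-1).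
    rewrite lt_min ltrBrDl => /andP[he hrho].
    apply: qG; first by apply: eU; rewrite (_ : x + h - x = h)//; ring.
    exact: le_lt_trans (modulusD _ _) hrho.
  have Ed := has_deriv_unique (near_eq_has_deriv e'0 qGnear dqG) dwv.
  have EG := qG x Ux xrho.
  have := FE _ _ xrho gd.
  suff -> : (recR r p q v).[x] * d + (recQ r p q v).[x] * G x
      + (recH r p v w).[x] * -1 = 0 by [].
  rewrite /recR /recQ /recH !(hornerD, hornerN, hornerZ, hornerM).
  move: EG Ed; rewrite mulr0 addr0.
  exact: ode_identity.
(* Convergence of g', hence of [F], is available only strictly inside [rho], so [F] gets its Abel
   bound at the midpoint. *)
have z0rho2 : modulus z0 < (modulus z0 + rho) / 2 by lra.
have rho2 : (modulus z0 + rho) / 2 < rho by lra.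
have FB : terms_bounded F ((modulus z0 + rho) / 2).
  pose y := real_complex R ((modulus z0 + rho) / 2).
  have yE : modulus y = (modulus z0 + rho) / 2.
    by rewrite modulus_real ger0_norm// divr_ge0// addr_ge0// modulus_ge0.
  rewrite -yE; apply: cvg_terms_bounded; apply/cvg_ex.
  have [|d gd _] := @has_deriv_termwise g rho G y grho _ gG.
    by rewrite yE.
  by eexists; apply: FE gd; rewrite yE.
have /near_modulusP[e e0 eU] : \forall y \near z0, U y.
  exact: open_nbhs_nbhs.
have e'0 : 0 < Num.min e (rho - modulus z0) by rewrite lt_min e0 subr_gt0.
suff : F n = 0 by rewrite /F mulrN1 => /eqP; rewrite subr_eq0 => /eqP.
apply: (cpseries_identity FB z0rho2 e'0) => h.
rewrite lt_min ltrBrDl => /andP[he hrho]; apply: F0.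
  by apply: eU; rewrite (_ : z0 + h - z0 = h)//; ring.
exact: le_lt_trans (modulusD _ _) hrho.
Qed.

End DifferentialEquation.

(** * Degrees of R, Q and H *)

Section Degrees.
Variable K : numFieldType.
Implicit Types (r : K) (p q v w : {poly K}).

Lemma size_deriv_num p : size p^`() = (size p).-1.
Proof.
have [->|p0] := eqVneq p 0; first by rewrite deriv0 size_poly0.
apply/eqP; rewrite eqn_leq -ltnS prednK ?size_poly_gt0// lt_size_deriv//=.
case E : (size p) => [|[|n]]//=; rewrite ltnNge; apply/negP => /leq_sizeP/(_ n).
rewrite leqnn coef_deriv => /(_ isT)/eqP; rewrite mulrn_eq0/=.
by have := lead_coef_eq0 p; rewrite /lead_coef E/= (negPf p0) => ->.
Qed.

Lemma deg_recR r p q v : r != 0 -> p != 0 -> q != 0 -> v != 0 ->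
  deg (recR r p q v) = (size p + size q + size v - 3)%N.
Proof.
move=> r0 p0 q0 v0; rewrite /deg size_scale// !size_mul ?mulf_neq0//.
by move: p0 q0; rewrite -!size_poly_gt0; move: (size p) (size q) (size v); lia.
Qed.

(** Each product in Q is p q v with one factor differentiated, which lowers the degree; for constant
    p, q, v it is 0. *)
Lemma size_recQ r p q v : r != 0 -> p != 0 -> q != 0 -> v != 0 ->
  (size (recQ r p q v) <= deg (recR r p q v))%N.
Proof.
move=> r0 p0 q0 v0; rewrite deg_recR//.
have sM (a b c : {poly K}) D : ((size a + (size b + size c).-1).-1 <= D)%N ->
    (size (a * (b * c))%R <= D)%N.
  apply: leq_trans; rewrite (leq_trans (size_polyMleq _ _))// -!subn1.
  by rewrite leq_sub2r// leq_add2l subn1 size_polyMleq.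
move: p0 q0 v0; rewrite -!size_poly_gt0 => p0 q0 v0.
rewrite /recQ mulrBr (leq_trans (size_polyD _ _))// size_polyN geq_max.
rewrite size_scale// (leq_trans (size_polyD _ _)) ?size_polyN ?geq_max/=.
  rewrite -mulrA sM// size_deriv_num; move: p0 q0 v0.
  by move: (size p) (size q) (size v); lia.
by rewrite !sM// size_deriv_num; move: p0 q0 v0;
  move: (size p) (size q) (size v); lia.
Qed.

(** A nonzero coefficient would force deg R = 0 and deg H = m. Then p and v are constant and H = r p
    v w', so m + 1 = deg w. *)
Lemma recH_coef_eq0 r p q v w m : r != 0 -> p != 0 -> q != 0 -> v != 0 ->
  (deg (recH r p v w) + deg (recR r p q v) <= m)%N ->
  (0 < deg (recR r p q v))%N \/ m.+1 <> deg w -> (recH r p v w)`_m = 0.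
Proof.
move=> r0 p0 q0 v0 mH mw; have [sH|sH] := leqP (size (recH r p v w)) m.
  exact: nth_default.
have {mH}[R0 mH] : deg (recR r p q v) = 0 /\ size (recH r p v w) = m.+1.
  move: mH sH; rewrite [deg (recH r p v w)]/deg.
  by move: (size (recH r p v w)) (deg (recR r p q v)); lia.
case: mw => [|[]]; first by rewrite R0.
move: R0 mH; rewrite deg_recR// => R0 <-.
move: p0 q0 v0; rewrite -!size_poly_gt0 => sp0 sq0 sv0.
have /size_poly1P[a a0 ->] : size p == 1%N.
  by move: R0 sp0 sq0 sv0; move: (size p) (size q) (size v); lia.
have /size_poly1P[b b0 ->] : size v == 1%N.
  by move: R0 sp0 sq0 sv0; move: (size p) (size q) (size v); lia.
rewrite /recH !derivC !(mulr0, mul0r, subr0) size_scale// mulrCA mulrC.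
by rewrite -mulrA !mul_polyC !size_scale// size_deriv_num.
Qed.

End Degrees.

(** Multiplying the equation by x aligns both sums at index m + 1: x g' has coefficients k g_k, and
    ['X * Q] carries the shift to Q_(j-1). The added terms, j = m + 1 in the first sum and j = 0 in
    the second, are 0. *)
Lemma convolve_deriv (R : realType) (P Q : {poly R[i]})
    (g : nat -> R[i]) m :
  convolve P (termwise_deriv g) m + convolve Q g m =
  \sum_(j < m.+2) ((m.+1 - j)%:R * P`_j + ('X * Q)`_j) * g (m.+1 - j)%N.
Proof.
under [RHS]eq_bigr do rewrite mulrDl; rewrite big_split/=; congr (_ + _).
  rewrite big_ord_recr/= subnn !mul0r addr0; apply: eq_bigr => j _.
  by rewrite /termwise_deriv -subSn -1?ltnS//; ring.
rewrite big_ord_recl coefXM/= mul0r add0r; apply: eq_bigr => j _.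
by rewrite coefXM /bump/= add1n subSS.
Qed.

(* The last hypothesis removes the single instance (n = deg w, for constant
   p, q, v and non-constant w) at which the recurrence is false. *)
Theorem theorem5 (R : realType) (r : R[i]) (p q v w : {poly R[i]})
    (g : nat -> R[i]) (n : int) :
  r != 0 -> p != 0 -> q != 0 -> v != 0 ->
  is_expansion r p q v w g ->
  (deg (recH r p v w))%:Z < n - (deg (recR r p q v))%:Z ->
  (0 < deg (recR r p q v))%N \/ n <> (deg w)%:Z ->
  \sum_(0 <= j < (deg (recR r p q v)).+1)
     ((n - j%:Z)%:~R * coefz (recR r p q v) j%:Z
        + coefz (recQ r p q v) (j%:Z - 1))
       * ext0 g (n - j%:Z) = 0.
Proof.
(* The bound forces n > 0, so only n = m + 1 survives. *)
move=> r0 p0 q0 v0 gexp; case: n => [[|m]|m] nH nw; try by lia.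
set RR := recR r p q v in nH nw *; set QQ := recQ r p q v.
set D := deg RR in nH nw *.
have Dm : (D < m.+1)%N by lia.
have HD : (deg (recH r p v w) + D <= m)%N by lia.
have H0 : (recH r p v w)`_m = 0.
  apply: (recH_coef_eq0 r0 p0 q0 v0 HD).
  by case: nw => [|nw]; [left|right => mw; apply: nw; rewrite mw].
have := expansion_ode m r0 gexp; rewrite convolve_deriv H0.
move=> ode; rewrite -[RHS]ode big_mkord.
pose F (j : nat) := ((m.+1%:Z - j%:Z)%:~R * coefz RR j%:Z
  + coefz QQ (j%:Z - 1)) * ext0 g (m.+1%:Z - j%:Z).
(* The sum is extended to j <= m + 1; for j > D both R_j and Q_(j-1) are 0, the latter because Q has
   size at most D. *)
rewrite (big_ord_widen _ F (leqW Dm)) big_mkcond/=.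
apply: eq_bigr => j _; rewrite -/RR -/QQ {}/F.
case: ifPn => [jD|]; last first.
  rewrite -ltnNge => Dj; rewrite coefXM.
  rewrite (@nth_default _ _ RR); last by rewrite (leq_trans (leqSpred _)).
  rewrite (@nth_default _ _ QQ); last first.
    by rewrite (leq_trans (size_recQ r0 p0 q0 v0))// -/RR -/D; lia.
  by rewrite if_same mulr0 add0r mul0r.
have jm : (j <= m.+1)%N by lia.
rewrite subzn//= coefXM; congr ((_ + _) * _).
(* At j = 0 the value of [coefz] at -1 and the constant coefficient of ['X * Q] are both 0. *)
case: (nat_of_ord j) => [|k]; first by [].
by rewrite (_ : k.+1%:Z - 1 = k%:Z); last lia.
Qed.
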